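(* Let $\mathcal T=(T_t)_{t>0}$ be a 2-positive and contractive analytic semigroup acting on a von Neumann algebra $\mathcal M$ and let $\alpha>0$. Let $k$ be any integer greater than $\alpha$. Then the spaces $\mathcal L^c_{\alpha,k}(\mathcal T)$ and $\mathcal L^c_\alpha(\mathcal T)$ coincide, with equivalent norms.
   Context: Let $\mathcal M$ be a von Neumann algebra with operator norm $\|\cdot\|_\infty$ and predual $L^1(\mathcal M)$; $|x|^2=x^*x$; $[\alpha]$ is the integer part of $\alpha$; $I$ is the identity map on $\mathcal M$. A family of linear operators $\mathcal T=(T_t)_{t>0}$ on $\mathcal M$ is a semigroup if $T_0=\mathrm{id}$ and $T_tT_s=T_{t+s}$ for $s,t>0$. It is called 2-positive and contractive if (i) each $T_t$ is 2-positive, i.e. $\mathrm{id}_{M_2}\otimes T_t$ is positive on $M_2\otimes\mathcal M$ ($M_2$ being the $2\times2$ complex matrices); (ii) $\|T_tf\|_\infty\le\|f\|_\infty$ for all $t>0$, $f\in\mathcal M$; (iii) for every $f\in\mathcal M$, $T_tf\to f$ in the weak-$*$ topology as $t\to0^+$. Such a semigroup is called analytic if there is $\delta\in(0,\pi/2)$ such that $(T_t)_{t>0}$ extends to a bounded map $z\in\Sigma_\delta\mapsto T_z\in B(\mathcal M)$, where $\Sigma_\delta=\{z\in\mathbb C\setminus\{0\}:|\mathrm{Arg}(z)|<\delta\}$, with $z\mapsto\langle T_zx,\varphi\rangle$ holomorphic on $\Sigma_\delta$ for all $x\in\mathcal M$, $\varphi\in L^1(\mathcal M)$. For an integer $k>\alpha$,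 the space $\mathcal L^c_{\alpha,k}(\mathcal T)$ is the space of $f\in\mathcal M$ with $$\|f\|_{\mathcal L^c_{\alpha,k}(\mathcal T)}=\|f\|_\infty+\sup_{t>0}\frac1{t^\alpha}\left\|T_t\left|(I-T_t)^{k}f\right|^2\right\|_\infty^{1/2}<\infty ,$$ and $\mathcal L^c_\alpha(\mathcal T)$ is the space of $f\in\mathcal M$ with $$\|f\|_{\mathcal L^c_\alpha(\mathcal T)}=\|f\|_\infty+\sup_{t>0}\frac1{t^\alpha}\left\|T_t\left|(I-T_t)^{[\alpha]+1}f\right|^2\right\|_\infty^{1/2}<\infty .$$ Equivalence of norms means two-sided bounds with positive constants not depending on $f$. *)

(* Defs.v *)
From mathcomp Require Import all_boot all_order all_algebra.
From mathcomp Require Import sesquilinear complex.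
From mathcomp Require Import all_classical all_reals all_analysis.

Set Implicit Arguments.
Unset Strict Implicit.
Unset Printing Implicit Defensive.

Import Order.TTheory GRing.Theory Num.Theory.
Import numFieldNormedType.Exports.

Local Open Scope classical_set_scope.
Local Open Scope ring_scope.
Local Open Scope complex_scope.

(* A complex Hilbert space is a complete normed space [H] over [R[i]] whose
   norm comes from the inner product [dot], linear in its first argument.
   Operators on [H] are plain maps [H -> H]; their product is [\o], their unit
   is [idfun], and their sum and scaling are pointwise. Maps between algebras
   of operators are only constrained on the algebra [M] on which they act. *)
Section OperatorAlgebras.
Context {R : realType} {H : completeNormedModType R[i]}.
Variable dot : {dot H for Num.conj}.

Definition is_hilbert := forall u : H, dot u u = `|u| ^+ 2.

Definition bounded_op (x : H -> H) := linear x /\ continuous x.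

(* The norm of [H] takes its values in the nonnegative reals of [R[i]]. *)
Definition opnorm (x : H -> H) : R :=
  sup [set complex.Re `|x u| | u in [set u : H | `|u| <= 1]].

Definition is_adjoint (x y : H -> H) := forall u v, dot (x u) v = dot u (y v).

(* The default value [idfun] is never used for bounded [x]. *)
Definition adjoint (x : H -> H) : H -> H :=
  xget (idfun : H -> H) [set y | is_adjoint x y].

Definition abs2 (x : H -> H) : H -> H := adjoint x \o x.

Definition commutant (S : set (H -> H)) : set (H -> H) :=
  [set y | bounded_op y /\ forall x, S x -> y \o x = x \o y].

Definition von_neumann_algebra (M : set (H -> H)) :=
  (forall x, M x -> exists2 y, M y & is_adjoint x y) /\
  commutant (commutant M) = M.

(* The predual of [M]: the ultraweakly continuous functionals on [M], i.e. the
   restrictions to [M] of the trace-class functionals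
   [x |-> \sum_n <x xi_n, eta_n>]. *)
Definition predual (M : set (H -> H)) : set ((H -> H) -> R[i]) :=
  [set phi | exists xi eta : nat -> H,
     [/\ cvgn (series (fun n => complex.Re `|xi n| ^+ 2)),
         cvgn (series (fun n => complex.Re `|eta n| ^+ 2)) &
         forall x, M x ->
           series (fun n => dot (x (xi n)) (eta n) : R[i]^o) @ \oo
             --> (phi x : R[i]^o)]].

Definition linear_on (M : set (H -> H)) (Phi : (H -> H) -> (H -> H)) :=
  (forall x, M x -> M (Phi x)) /\
  (forall (a : R[i]) x y, M x -> M y -> Phi (a *: x + y) = a *: Phi x + Phi y).

(* An [n x n] matrix of operators acts on the Hilbert sum of [n] copies of
   [H]; under the identification of the tensor product of [M_n] and [M] with
   the [n x n] matrices over [M], [id \otimes Phi] is [map_mx Phi]. *)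
Definition positive_mx n (X : 'M[H -> H]_n) :=
  forall xi : 'I_n -> H, 0 <= \sum_i \sum_j dot (X i j (xi j)) (xi i).

Definition n_positive n (M : set (H -> H)) (Phi : (H -> H) -> (H -> H)) :=
  forall X : 'M[H -> H]_n, (forall i j, M (X i j)) ->
    positive_mx X -> positive_mx (map_mx Phi X).

Definition semigroup_on (M : set (H -> H)) (T : R -> (H -> H) -> (H -> H)) :=
  [/\ forall t, 0 < t -> linear_on M (T t),
      forall x, M x -> T 0 x = x &
      forall s t x, 0 < s -> 0 < t -> M x -> T (t + s) x = T t (T s x)].

Definition two_positive_contractive (M : set (H -> H))
    (T : R -> (H -> H) -> (H -> H)) :=
  [/\ forall t, 0 < t -> n_positive 2 M (T t),
      forall t f, 0 < t -> M f -> opnorm (T t f) <= opnorm f &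
      forall f phi, M f -> predual M phi ->
        (phi (T t f) : R[i]^o) @[t --> 0^'+] --> (phi f : R[i]^o)].

(* For [0 < delta < pi], the nonzero [z] with [|Arg z| < delta]. *)
Definition sector (delta : R) : set R[i] :=
  [set z | exists r theta : R, [/\ 0 < r, `|theta| < delta &
     z = (r * cos theta) +i* (r * sin theta)]].

Definition analytic (M : set (H -> H)) (T : R -> (H -> H) -> (H -> H)) :=
  exists (delta : R) (Tz : R[i] -> (H -> H) -> (H -> H)),
    [/\ 0 < delta < pi / 2,
        forall t x, 0 < t -> M x -> Tz t%:C x = T t x,
        forall z, sector delta z -> linear_on M (Tz z),
        exists K : R, forall z x, sector delta z -> M x ->
          opnorm (Tz z x) <= K * opnorm x &
        forall x phi z, M x -> predual M phi -> sector delta z ->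
          derivable (fun w : R[i]^o => phi (Tz w x) : R[i]^o) z 1].

Definition lip_norm (T : R -> (H -> H) -> (H -> H)) (alpha : R) (k : nat)
    (f : H -> H) : \bar R :=
  ((opnorm f)%:E +
   ereal_sup [set ((t `^ alpha)^-1 *
       Num.sqrt (opnorm (T t (abs2 (iter k (fun g => g - T t g) f)))))%:E
     | t in [set t : R | (0 < t)%R]])%E.

Definition lip_space (M : set (H -> H)) (T : R -> (H -> H) -> (H -> H))
    (alpha : R) (k : nat) : set (H -> H) :=
  [set f | M f /\ (lip_norm T alpha k f < +oo)%E].

End OperatorAlgebras.

(* Main.v *)
From HB Require Import structures.
Require Import Defs.
From mathcomp Require Import all_boot all_order all_algebra.
From mathcomp Require Import sesquilinear complex.
From mathcomp Require Import all_classical all_reals all_analysis.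
From mathcomp Require Import ring lra.

Set Implicit Arguments.
Unset Strict Implicit.
Unset Printing Implicit Defensive.

Import Order.TTheory GRing.Theory Num.Theory.
Import numFieldNormedType.Exports.

Local Open Scope classical_set_scope.
Local Open Scope ring_scope.
Local Open Scope complex_scope.

(** Put [p_t g = || T_t |g|^2 ||^(1/2)], a seminorm because [T_t] is positive.  The
    Kadison-Schwarz inequality [|T_s g|^2 <= T_s |g|^2] (positivity of
    [id (x) T_s] on the matrix [[1, g], [g^*, g^* g]]) gives
    [p_t (T_s g) <= p_t g] and, since [p_t <= ||.||] and [||T_s g|| <= p_s g],
    also [p_t (T_s g) <= p_s g].  Write [D_s = I - T_s] and [E_s = I + T_s], so
    that [D_{2s} = E_s D_s].  The bound on [p_t D_t^k f] gives the one on
    [p_t D_t^{k+1} f] with a factor [2].  Conversely, if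
    [p_s (D_s^{k+1} f) <= A s^alpha] for all [s], then [T_s] smooths all terms
    but the first in the expansion of [E_s^{k+1}], hence
      [p_t (D_{2s}^{k+1} f) <= p_t (D_s^{k+1} f) + c A s^alpha],
    and summation over [s = 2^n t] bounds [p_t (D_s^{k+1} f)] by [C A s^alpha]
    for these [s], although [t] stays fixed.  As [2^k - E_s^k] is a multiple of
    [D_s], Marchaud's inequality
      [2^k p_t (D_s^k f) <= p_t (D_{2s}^k f) + c p_t (D_s^{k+1} f)]
    can be iterated along [s = 2^n t]; it converges because [alpha < k]. *)

(** * Marchaud's inequality for a family of seminorms *)

(** Summing a geometric series, [b n] grows at most like [r ^+ n]. The excess of [a n] over
    [G * (X * r ^+ n)] is then at least multiplied by [2 ^+ k] at each step, so a positive excess at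
    [0] would contradict the bound [K], which therefore does not enter the constant. *)
Lemma marchaud_iteration (R : realType) (r c K X : R) (k : nat) (a b : nat -> R) :
  1 < r -> r < 2 ^+ k -> 0 <= c -> 0 <= X ->
  b 0 <= X -> (forall n, b n.+1 <= b n + c * (X * r ^+ n)) ->
  (forall n, 2 ^+ k * a n <= a n.+1 + c * b n) ->
  (forall n, a n <= K) ->
  a 0 <= c * (1 + c / (r - 1)) / (2 ^+ k - r) * X.
Proof.
move=> r1 rk c0 X0 b0 bS aS aK.
(* Both constants make an induction close: [B * r] is at least [B + c], and [G] solves
   [G * 2 ^+ k = G * r + c * B]. *)
set B := 1 + c / (r - 1); set G := c * B / _.
have Br : B * r = B + (r - 1) + c by rewrite /B; field; lra.
have Gr : G * 2 ^+ k = G * r + c * B by rewrite /G; field; lra.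
have B0 : 0 <= B by rewrite addr_ge0// divr_ge0//; lra.
have G0 : 0 <= G by rewrite divr_ge0 ?mulr_ge0//; lra.
have Y0 n : 0 <= X * r ^+ n by rewrite mulr_ge0// exprn_ge0//; lra.
have bn n : b n <= B * (X * r ^+ n).
  elim: n => [|n IH].
    by rewrite expr0 mulr1 (le_trans b0)// ler_peMl// lerDl divr_ge0//; lra.
  apply: le_trans (bS n) _; apply: le_trans (lerD IH (lexx _)) _.
  have -> : B * (X * r ^+ n.+1) = B * r * (X * r ^+ n) by rewrite exprS; ring.
  by rewrite Br -mulrDl ler_wpM2r//; lra.
have an n : 2 ^+ k ^+ n * (a 0 - G * X) <= a n - G * (X * r ^+ n).
  elim: n => [|n IH]; first by rewrite !expr0 mulr1 mul1r.
  rewrite exprS -mulrA; apply: le_trans (ler_wpM2l _ IH) _.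
    by rewrite exprn_ge0.
  have -> : G * (X * r ^+ n.+1) = (G * 2 ^+ k - c * B) * (X * r ^+ n).
    by rewrite Gr exprS; ring.
  have := aS n; have := ler_wpM2l c0 (bn n).
  move: (X * r ^+ n) (2 ^+ k : R) => Y Z.
  by move: B G {Br Gr bn IH B0 G0} => B G; lra.
rewrite leNgt -subr_gt0; apply/negP; set e := _ - _ => e0.
(* For [k = 0] the hypotheses would read [1 < r < 1]. Once [0 < k], the factor [2 ^+ k ^+ n] exceeds
   [n], and Archimedes gives the contradiction. *)
have k0 : (0 < k)%N.
  by case: k rk {aS Gr an G0 G e e0} => //; rewrite expr0 => rk; lra.
have /archi_boundP : 0 <= `|K / e| by []; set n := Num.bound _ => nK.
have : n%:R <= K / e.
  rewrite ler_pdivlMr//; apply: le_trans (le_trans (an n) _); last first.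
    by have := aK n; have := mulr_ge0 G0 (Y0 n); lra.
  rewrite ler_pM2r// -exprM -natrX ler_nat; apply: ltnW.
  by apply: leq_trans (ltn_expl n (ltnSn 1)) _; rewrite leq_exp2l// leq_pmull.
by rewrite leNgt (le_lt_trans (ler_norm _) nK).
Qed.

Section Marchaud.
Context {R : realType} {V : zmodType}.
(** In the application [p] is [lip_seminorm] and [q] the operator norm. Only the additive structure
    is kept, with [p_double] in place of homogeneity. *)
Variables (M : set V) (T : R -> V -> V) (p : R -> V -> R) (q : V -> R).
Hypothesis MD : forall x y, M x -> M y -> M (x + y).
Hypothesis MB : forall x y, M x -> M y -> M (x - y).
Hypothesis TM : forall t x, 0 < t -> M x -> M (T t x).
Hypothesis TD : forall t x y, 0 < t -> M x -> M y -> T t (x + y) = T t x + T t y.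
Hypothesis TB : forall t x y, 0 < t -> M x -> M y -> T t (x - y) = T t x - T t y.
Hypothesis TT : forall t x, 0 < t -> M x -> T (t + t) x = T t (T t x).
Hypothesis p_ge0 : forall t x, 0 <= p t x.
Hypothesis pD : forall t x y, 0 < t -> M x -> M y -> p t (x + y) <= p t x + p t y.
Hypothesis pB : forall t x y, 0 < t -> M x -> M y -> p t (x - y) <= p t x + p t y.
Hypothesis p_double : forall t x, 0 < t -> M x -> 2 * p t x <= p t (x + x).
Hypothesis pT : forall t s x, 0 < t -> 0 < s -> M x -> p t (T s x) <= p t x.
Hypothesis pT_smooth :
  forall t s x, 0 < t -> 0 < s -> M x -> p t (T s x) <= p s x.
Hypothesis pq : forall t x, 0 < t -> M x -> p t x <= q x.

Let D t g := g - T t g.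
Let E t g := g + T t g.

Let DM t x : 0 < t -> M x -> M (D t x).
Proof. by move=> t0 Mx; apply: MB => //; apply: TM. Qed.

Let EM t x : 0 < t -> M x -> M (E t x).
Proof. by move=> t0 Mx; apply: MD => //; apply: TM. Qed.

Let iterDM n t x : 0 < t -> M x -> M (iter n (D t) x).
Proof. by move=> t0 Mx; elim: n => //= n; exact: DM. Qed.

Let iterEM n t x : 0 < t -> M x -> M (iter n (E t) x).
Proof. by move=> t0 Mx; elim: n => //= n; exact: EM. Qed.

Let DE t x : 0 < t -> M x -> D t (E t x) = E t (D t x).
Proof.
move=> t0 Mx; have MTx := TM t0 Mx.
by rewrite /D /E TD// TB// opprD addrACA.
Qed.

Let pD_le t s x : 0 < t -> 0 < s -> M x -> p t (D s x) <= 2 * p t x.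
Proof.
move=> t0 s0 Mx; apply: le_trans (pB t0 Mx (TM s0 Mx)) _.
by have := pT t0 s0 Mx; lra.
Qed.

Let pE_le t s x : 0 < t -> 0 < s -> M x -> p t (E s x) <= 2 * p t x.
Proof.
move=> t0 s0 Mx; apply: le_trans (pD t0 Mx (TM s0 Mx)) _.
by have := pT t0 s0 Mx; lra.
Qed.

Let p_iterD_le n t s x : 0 < t -> 0 < s -> M x ->
  p t (iter n (D s) x) <= 2 ^+ n * p t x.
Proof.
move=> t0 s0 Mx; elim: n => [|n IH]; first by rewrite mul1r.
apply: le_trans (pD_le t0 s0 (iterDM n s0 Mx)) _.
by rewrite exprS -mulrA ler_pM2l.
Qed.

Let p_iterE_le n t s x : 0 < t -> 0 < s -> M x ->
  p t (iter n (E s) x) <= 2 ^+ n * p t x.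
Proof.
move=> t0 s0 Mx; elim: n => [|n IH]; first by rewrite mul1r.
apply: le_trans (pE_le t0 s0 (iterEM n s0 Mx)) _.
by rewrite exprS -mulrA ler_pM2l.
Qed.

(* Only the first [p] is taken at the time [t]: each further term carries a
   factor [T s], and is therefore controlled at the larger scale [s]. *)
Let p_iterE n t s x : 0 < t -> 0 < s -> M x ->
  p t (iter n (E s) x) <= p t x + (2 ^+ n - 1) * p s x.
Proof.
move=> t0 s0 Mx; elim: n => [|n IH]; first by rewrite expr0 subrr mul0r addr0.
have ME := iterEM n s0 Mx.
apply: le_trans (pD t0 ME (TM s0 ME)) _.
have := pT_smooth t0 s0 ME; have := p_iterE_le n s0 s0 Mx.
by rewrite exprS; lra.
Qed.

Let iterD_double n s x : 0 < s -> M x ->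
  iter n (D (s + s)) x = iter n (E s) (iter n (D s) x).
Proof.
move=> s0 Mx.
have D2 y : M y -> D (s + s) y = E s (D s y).
  move=> My; rewrite -DE// /D /E TD// ?TT//; last exact: TM.
  by rewrite opprD addrACA addrA subrK.
have swap m y : M y -> D s (iter m (E s) y) = iter m (E s) (D s y).
  by move=> My; elim: m => //= m IH; rewrite DE ?IH//; exact: iterEM.
elim: n => //= n ->; rewrite D2 ?swap//; first exact: iterDM.
by apply: iterEM => //; apply: iterDM.
Qed.

(** Quantitative form of the divisibility of [2^k - E_s^k] by [D_s]. In the induction the
    coefficient of [p t (D s g)] becomes [2 * 4 ^+ k + 2 ^+ k], which stays below [4 ^+ k.+1]. *)
Let marchaud_step k t s g : 0 < t -> 0 < s -> M g ->
  2 ^+ k * p t g <= p t (iter k (E s) g) + 4 ^+ k * p t (D s g).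
Proof.
move=> t0 s0; elim: k g => [|k IH] g Mg.
  by rewrite !mul1r lerDl.
have ME := EM s0 Mg; have MDg := DM s0 Mg.
(* [2 = E_s + D_s] *)
have gE : g + g = E s g + D s g by rewrite /E /D addrACA subrr addr0.
have h1 : 2 * p t g <= p t (E s g) + p t (D s g).
  by apply: le_trans (p_double t0 Mg) _; rewrite gE; exact: pD.
have := IH _ ME; rewrite DE// -iterSr.
have := ler_wpM2l (exprn_ge0 k (ler0n R 4)) (pE_le t0 s0 MDg).
have := ler_wpM2l (exprn_ge0 k (ler0n R 2)) h1.
have : 2 ^+ k * p t (D s g) <= 4 ^+ k * p t (D s g).
  by apply: ler_wpM2r => //; apply: lerXn2r; rewrite ?nnegrE ?ler_nat.
have : 0 <= 4 ^+ k * p t (D s g) by rewrite mulr_ge0 ?exprn_ge0.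
rewrite !exprS; lra.
Qed.

Lemma seminorm_difference_succ k (alpha A : R) f : M f ->
  (forall t, 0 < t -> p t (iter k (D t) f) <= A * t `^ alpha) ->
  forall t, 0 < t -> p t (iter k.+1 (D t) f) <= 2 * A * t `^ alpha.
Proof.
move=> Mf Hf t t0; apply: le_trans (pD_le t0 t0 (iterDM k t0 Mf)) _.
by rewrite -mulrA ler_pM2l// Hf.
Qed.

Lemma seminorm_difference_pred k (alpha : R) : 0 < alpha -> alpha < k%:R ->
  exists2 C, 0 <= C & forall f A, M f -> 0 <= A ->
  (forall t, 0 < t -> p t (iter k.+1 (D t) f) <= A * t `^ alpha) ->
  forall t, 0 < t -> p t (iter k (D t) f) <= C * A * t `^ alpha.
Proof.
(* [r] is the growth of the power [alpha] of the scale under doubling, so [r < 2 ^+ k] expresses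
   [alpha < k]. [c] dominates both the smoothing constant [2 ^+ k.+1 - 1] and the constant [4 ^+ k]
   of [marchaud_step]. *)
move=> a0 ak; pose r := 2 `^ alpha; pose c : R := 4 ^+ k.+1.
have mono x y : x < y -> 2 `^ x < 2 `^ y :> R.
  by move=> xy; rewrite /powR pnatr_eq0 ltr_expR ltr_pM2r// ln_gt0// ltr1n.
have r1 : 1 < r by rewrite -(powRr0 2) mono.
have rk : r < 2 ^+ k by rewrite -powR_mulrn// mono.
have c0 : 0 <= c by rewrite exprn_ge0.
exists (c * (1 + c / (r - 1)) / (2 ^+ k - r)).
  rewrite divr_ge0 ?(subr_ge0, ltW rk)// mulr_ge0// addr_ge0// divr_ge0//.
  by rewrite subr_ge0 ltW.
move=> f A Mf A0 Hf t t0.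
pose s n : R := 2 ^+ n * t.
have s0 n : 0 < s n by rewrite mulr_gt0// exprn_gt0.
have sS n : s n.+1 = s n + s n by rewrite /s exprS; ring.
have s1 : s 0 = t by rewrite /s mul1r.
have spow n : s n `^ alpha = r ^+ n * t `^ alpha.
  rewrite /s powRM ?exprn_ge0 ?(ltW t0)//.
  by rewrite -[2 ^+ n]powR_mulrn// powRAC powR_mulrn// powR_ge0.
(* Only the scale of the differences becomes [s 0] and will double; the time of the seminorm remains
   [t]. *)
rewrite -mulrA -[in iter _ _ _]s1.
apply: (@marchaud_iteration _ r c (2 ^+ k * q f) (A * t `^ alpha) k
  (fun n => p t (iter k (D (s n)) f)) (fun n => p t (iter k.+1 (D (s n)) f))) => //.
- by rewrite mulr_ge0// powR_ge0.
- by rewrite s1; exact: Hf.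
- move=> n; rewrite sS iterD_double//.
  apply: le_trans (p_iterE _ t0 (s0 n) (iterDM _ (s0 n) Mf)) _.
  rewrite lerD2l; apply: ler_pM => //.
  + by rewrite subr_ge0 -natrX ler1n expn_gt0.
  + rewrite lerBlDr; apply: (@le_trans _ _ c); last by rewrite lerDl.
    by rewrite /c -!natrX ler_nat leq_exp2r.
  + by rewrite [_ * r ^+ n]mulrC mulrCA -spow; exact: Hf.
- move=> n; rewrite sS iterD_double//.
  apply: le_trans (marchaud_step _ t0 (s0 n) (iterDM _ (s0 n) Mf)) _.
  by rewrite lerD2l// ler_wpM2r// /c exprS ler_peMl ?exprn_ge0// ler1n.
- move=> n; apply: le_trans (p_iterD_le _ t0 (s0 n) Mf) _.
  by rewrite ler_pM2l ?exprn_gt0// pq.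
Qed.

End Marchaud.

(** * Positive operators on a Hilbert space *)

Section Operators.
Context {R : realType} {H : completeNormedModType R[i]}.
Variable dot : {dot H for Num.conj}.
Hypothesis hH : is_hilbert dot.

Definition rnorm (u : H) : R := complex.Re `|u|.
Definition rdot u v : R := complex.Re (dot u v).

Lemma rnormE u : `|u| = (rnorm u)%:C.
Proof. by rewrite RRe_real// normr_real. Qed.

Lemma rnorm_ge0 u : 0 <= rnorm u.
Proof. by rewrite -lecR -rnormE normr_ge0. Qed.

Lemma rnormD u v : rnorm (u + v) <= rnorm u + rnorm v.
Proof. by rewrite -lecR rmorphD /= -!rnormE ler_normD. Qed.

Lemma rnormZ (a : R) u : rnorm (a%:C *: u) = `|a| * rnorm u.
Proof.
apply: (@complexI R); rewrite rmorphM /= -!rnormE normrZ; congr (_ * _).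
by rewrite normc_def /= expr0n addr0 sqrtr_sqr.
Qed.

Lemma dotuu u : dot u u = (rnorm u ^+ 2)%:C.
Proof. by rewrite hH rnormE -rmorphXn. Qed.

Lemma rdotuu u : rdot u u = rnorm u ^+ 2.
Proof. by rewrite /rdot dotuu. Qed.

Lemma rdotDl u v w : rdot (u + v) w = rdot u w + rdot v w.
Proof. by rewrite /rdot linearDl raddfD. Qed.

Lemma dotC u v : dot u v = (dot v u)^*%R.
Proof. by rewrite hermC expr0 mul1r. Qed.

Lemma rdotC u v : rdot u v = rdot v u.
Proof.
have Re_conj (z : R[i]) : complex.Re z^*%R = complex.Re z by case: z.
by rewrite /rdot dotC; exact: Re_conj.
Qed.

Lemma rdotDr u v w : rdot w (u + v) = rdot w u + rdot w v.
Proof. by rewrite rdotC rdotDl !(rdotC w). Qed.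

Lemma rdotZl (a : R) u v : rdot (a%:C *: u) v = a * rdot u v.
Proof.
by rewrite /rdot linearZl_LR /=; case: (dot u v) => x y /=; rewrite mul0r subr0.
Qed.

Lemma rdotZr (a : R) u v : rdot u (a%:C *: v) = a * rdot u v.
Proof. by rewrite rdotC rdotZl rdotC. Qed.

Definition positive_op (A : H -> H) := forall u, 0 <= dot (A u) u.

Lemma linear_opD (A : H -> H) u v : linear A -> A (u + v) = A u + A v.
Proof. by move=> lA; have := lA 1 u v; rewrite !scale1r. Qed.

Lemma linear_op0 (A : H -> H) : linear A -> A 0 = 0.
Proof. by move=> lA; have := lA (-1) 0 0; rewrite scaler0 addr0 scaleN1r addNr. Qed.

Lemma linear_opZ (A : H -> H) a u : linear A -> A (a *: u) = a *: A u.
Proof. by move=> lA; rewrite -[a *: u]addr0 lA linear_op0// addr0. Qed.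

(* Polarization: [a] and [b] are the cross terms of a sesquilinear form that is
   nonnegative at [i u + v]. *)
Lemma Re_polar (a b x : R[i]) :
  complex.Im x = 0 -> complex.Im (x + 'i%C * a - 'i%C * b) = 0 ->
  complex.Re a = complex.Re b.
Proof.
case: a b x => [a1 a2] [b1 b2] [x1 x2] /= ->.
by rewrite !mul0r !mul1r !add0r => /eqP; rewrite subr_eq0 => /eqP.
Qed.

Lemma doti_l u v : dot ('i%C *: u) v = 'i%C * dot u v.
Proof. by rewrite linearZl_LR. Qed.

Lemma doti_r u v : dot u ('i%C *: v) = - ('i%C * dot u v).
Proof.
rewrite linearZr_LR /= -mulNr; congr (_ * _).
by apply/eqP; rewrite eq_complex /= oppr0 !eqxx.
Qed.

(** Nonnegativity in [R[i]] includes being real, so the quadratic form of [A] is real at ['i u], [v]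
    and ['i u + v]; polarization does the rest. *)
Lemma positive_op_sym A u v : linear A -> positive_op A -> rdot (A u) v = rdot (A v) u.
Proof.
move=> lA pA; apply: (@Re_polar _ _ (dot (A ('i%C *: u)) ('i%C *: u) + dot (A v) v)).
  by rewrite raddfD /= !ger0_Im ?addr0//; exact: pA.
rewrite -[RHS](ger0_Im (pA ('i%C *: u + v))); congr (complex.Im _).
rewrite linear_opD// linearDl /= !linearDr /= (linear_opZ _ u lA) !doti_l !doti_r.
ring.
Qed.

Lemma bounded_opP (x : H -> H) : bounded_op x ->
  exists2 K, 0 <= K & forall u, rnorm (x u) <= K * rnorm u.
Proof.
move=> [lx cx].
pose fl := GRing.isLinear.Build _ _ _ _ x lx.
pose f : {linear H -> H} := HB.pack x fl.
have /linear_boundedP/pinfty_ex_gt0[r r0 Hr] :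
  bounded_near f (nbhs (0 : H)) by apply: continuous_linear_bounded; exact: cx.
have rE : r = (complex.Re r)%:C by rewrite RRe_real// gtr0_real.
exists (complex.Re r); first by rewrite -lecR -rE ltW.
by move=> u; rewrite -lecR rmorphM /= -rE -!rnormE; exact: Hr.
Qed.

Lemma opnorm_le (x : H -> H) c : 0 <= c -> (forall u, rnorm (x u) <= c * rnorm u) ->
  opnorm x <= c.
Proof.
move=> c0 hc; apply: ge_sup.
  by exists (rnorm (x 0)); exists 0 => //=; rewrite normr0.
move=> _ [u /= u1 <-]; apply: le_trans (hc u) _.
by rewrite ler_piMr// -lecR -rnormE.
Qed.

Lemma le_opnorm (x : H -> H) u : bounded_op x -> rnorm (x u) <= opnorm x * rnorm u.
Proof.
move=> bx; have [K K0 hK] := bounded_opP bx; have lx := bx.1.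
have [nu0|nu0] := eqVneq (rnorm u) 0.
  by have := hK u; rewrite nu0 !mulr0.
have npos : 0 < rnorm u by rewrite lt_def nu0 rnorm_ge0.
rewrite -ler_pdivrMr// mulrC -[(rnorm u)^-1]ger0_norm ?invr_ge0 ?rnorm_ge0//.
rewrite -rnormZ -linear_opZ//; apply: ub_le_sup.
  exists K => _ [v /= v1 <-]; apply: le_trans (hK v) _.
  by rewrite ler_piMr// -lecR -rnormE.
exists ((rnorm u)^-1%:C *: u) => //=.
by rewrite rnormE rnormZ ger0_norm ?invr_ge0 ?rnorm_ge0// mulVf.
Qed.

Lemma opnorm_ge0 (x : H -> H) : bounded_op x -> 0 <= opnorm x.
Proof.
move=> bx; have [K K0 hK] := bounded_opP bx.
apply: (@le_trans _ _ (rnorm (x 0))); first exact: rnorm_ge0.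
apply: ub_le_sup; last by exists 0 => //=; rewrite normr0.
exists K => _ [v /= v1 <-]; apply: le_trans (hK v) _.
by rewrite ler_piMr// -lecR -rnormE.
Qed.

(** With [K] the operator norm, expanding [|x u - K u|^2 >= 0] gives [2 K <x u, u> <= |x u|^2 + K^2
    |u|^2 <= 2 K^2 |u|^2]. The case [K = 0] is separate because [K] is cancelled. *)
Lemma rdot_le (x : H -> H) u : bounded_op x -> rdot (x u) u <= opnorm x * rnorm u ^+ 2.
Proof.
move=> bx; have := le_opnorm u bx; have := opnorm_ge0 bx.
have := rnorm_ge0 u; have := rnorm_ge0 (x u).
move: (opnorm x) => K xu0 u0; rewrite le_eqVlt => /predU1P[<-|K0] xuK.
  have xu : x u = 0.
    by apply/eqP; rewrite -normr_eq0 rnormE; apply/eqP; congr (_ %:C); lra.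
  by rewrite xu /rdot linear0l /= mul0r.
have : 0 <= rnorm (x u + (- K)%:C *: u) ^+ 2 by rewrite exprn_ge0// rnorm_ge0.
rewrite -rdotuu !rdotDl !rdotDr !rdotZl !rdotZr !rdotuu (rdotC u) => h.
have h2 : rnorm (x u) ^+ 2 <= K ^+ 2 * rnorm u ^+ 2.
  by rewrite -exprMn; apply: lerXn2r => //; rewrite nnegrE// mulr_ge0// ltW.
rewrite -(ler_pM2l K0) -(ler_pM2l (@ltr0Sn R 1)); lra.
Qed.

(** Positivity at [K u - A u] and symmetry give [2 K |A u|^2 <= K^2 <A u, u> + <A (A u), A u>]. The
    bound on the form, used at [u] and at [A u], turns this into [|A u| <= K |u|]. The slack [e]
    makes [K = c + e] positive. *)
Lemma positive_op_opnorm_le A c : linear A -> positive_op A -> 0 <= c ->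
  (forall u, rdot (A u) u <= c * rnorm u ^+ 2) -> opnorm A <= c.
Proof.
move=> lA pA c0 hc; apply/ler_addgt0Pr => e e0.
apply: opnorm_le => [|u]; first by lra.
have K0 : 0 < c + e by lra.
have h v : rdot (A v) v <= (c + e) * rnorm v ^+ 2.
  by apply: le_trans (hc v) _; rewrite ler_wpM2r ?exprn_ge0 ?rnorm_ge0//; lra.
move: (c + e) K0 h => K K0 h.
have : 0 <= rdot (A (K%:C *: u + (-1)%:C *: A u)) (K%:C *: u + (-1)%:C *: A u).
  by have := pA (K%:C *: u + (-1)%:C *: A u); rewrite lecE /= => /andP[].
rewrite (linear_opD _ _ lA) !(linear_opZ _ _ lA) !rdotDl !rdotDr !rdotZl !rdotZr.
rewrite (positive_op_sym (A u) u lA pA) rdotuu => hpos.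
have := h u; have := h (A u) => h1 h2.
have h3 : K ^+ 2 * rdot (A u) u <= K ^+ 2 * (K * rnorm u ^+ 2).
  by rewrite ler_pM2l// exprn_gt0.
have : rnorm (A u) ^+ 2 <= (K * rnorm u) ^+ 2.
  by rewrite -(ler_pM2l K0); lra.
by rewrite ler_pXn2r ?nnegrE ?rnorm_ge0// mulr_ge0 ?rnorm_ge0// ltW.
Qed.

(** * 2-positive contractions *)

Section Algebra.
Variable M : set (H -> H).
Hypothesis hM : von_neumann_algebra dot M.

Lemma vna_bounded x : M x -> bounded_op x.
Proof. by rewrite -hM.2 => -[]. Qed.

(** Closure under the algebra operations is read off from [M] being a commutant. *)
Lemma vna_comb a x y : M x -> M y -> M (a *: x + y).
Proof.
rewrite -hM.2 => -[[lx cx] hx] [[ly cy] hy]; split.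
  split=> [b u v|u].
    by rewrite !fctE lx ly !scalerDr !scalerA mulrC addrACA.
  by apply: continuousD; [apply: continuousZl_tmp; exact: cx | exact: cy].
move=> z Mz; apply/funext => u; have lz := Mz.1.1; rewrite !fctE /=.
rewrite lz; congr (a *: _ + _).
  by have /(congr1 (@^~ u)) := hx z Mz.
by have /(congr1 (@^~ u)) := hy z Mz.
Qed.

Lemma vna_comp x y : M x -> M y -> M (x \o y).
Proof.
rewrite -hM.2 => -[[lx cx] hx] [[ly cy] hy]; split.
  split=> [b u v|u] /=; first by rewrite ly lx.
  by apply: continuous_comp; [exact: cy | exact: cx].
move=> z Mz; apply/funext => u /=.
have := hy z Mz => /(congr1 (@^~ u)) /= ->.
by have := hx z Mz => /(congr1 (@^~ (y u))).
Qed.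

Lemma vna_id : M idfun.
Proof. by rewrite -hM.2; split=> // ; split=> // u; exact: cvg_id. Qed.

Lemma vnaD x y : M x -> M y -> M (x + y).
Proof. by move=> Mx My; rewrite -[x]scale1r; exact: vna_comb. Qed.

Lemma vna0 : M 0.
Proof. by rewrite -(addNr idfun) -scaleN1r; exact: vna_comb vna_id vna_id. Qed.

Lemma vnaZ a x : M x -> M (a *: x).
Proof. by move=> Mx; rewrite -[a *: x]addr0; exact: vna_comb Mx vna0. Qed.

Lemma vnaB x y : M x -> M y -> M (x - y).
Proof. by move=> Mx My; rewrite addrC -scaleN1r; exact: vna_comb. Qed.

Lemma is_adjoint_inj (x y z : H -> H) :
  is_adjoint dot x y -> is_adjoint dot x z -> y = z.
Proof.
move=> xy xz; apply/funext => v; apply/eqP; rewrite -subr_eq0 -(dnorm_eq0 dot).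
by rewrite linearBr /= -xy -xz subrr.
Qed.

Lemma adjointP x : M x -> is_adjoint dot x (adjoint dot x).
Proof.
by move=> Mx; have [y _ xy] := hM.1 x Mx; exact: (xgetI _ xy).
Qed.

Lemma vna_adjoint x : M x -> M (adjoint dot x).
Proof.
move=> Mx; have [y My xy] := hM.1 x Mx.
by rewrite (is_adjoint_inj (adjointP Mx) xy).
Qed.

Lemma dot_adjoint x u v : M x -> dot (adjoint dot x u) v = dot u (x v).
Proof.
by move=> Mx; rewrite dotC [RHS]dotC (adjointP Mx).
Qed.

Lemma vna_abs2 x : M x -> M (abs2 dot x).
Proof. by move=> Mx; apply: vna_comp => //; exact: vna_adjoint. Qed.

Lemma rdot_abs2 x u : M x -> rdot (abs2 dot x u) u = rnorm (x u) ^+ 2.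
Proof. by move=> Mx; rewrite /rdot /abs2 /= dot_adjoint// dotuu. Qed.

Lemma positive_op_abs2 x : M x -> positive_op (abs2 dot x).
Proof.
by move=> Mx u; rewrite /abs2 /= dot_adjoint// dnorm_ge0.
Qed.

Lemma opnorm_abs2_le x c : M x -> 0 <= c -> (forall u, rnorm (x u) <= c * rnorm u) ->
  opnorm (abs2 dot x) <= c ^+ 2.
Proof.
move=> Mx c0 hc; apply: positive_op_opnorm_le.
- exact: (vna_bounded (vna_abs2 Mx)).1.
- exact: positive_op_abs2.
- exact: exprn_ge0.
- move=> u; rewrite rdot_abs2// -exprMn.
  by apply: lerXn2r => //; rewrite nnegrE ?rnorm_ge0// mulr_ge0 ?rnorm_ge0.
Qed.

Definition two_by_two (A B C D : H -> H) : 'M[H -> H]_2 :=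
  \matrix_(i, j) if i == 0 then (if j == 0 then A else B)
                 else (if j == 0 then C else D).

Lemma positive_two_by_two A B C D :
  positive_mx dot (two_by_two A B C D) <->
  forall u v, 0 <= dot (A u) u + dot (B v) u + (dot (C u) v + dot (D v) v).
Proof.
split=> [h u v|h xi].
  have := h (fun i => if i == 0 then u else v).
  by rewrite !big_ord_recl !big_ord0 !mxE /= !addr0.
by rewrite !big_ord_recl !big_ord0 !mxE /= !addr0; exact: h.
Qed.

Lemma map_two_by_two (Phi : (H -> H) -> H -> H) A B C D :
  map_mx Phi (two_by_two A B C D) = two_by_two (Phi A) (Phi B) (Phi C) (Phi D).
Proof.
by apply/matrixP => i j; rewrite !mxE; case: ifP => _; case: ifP.
Qed.

Section TwoPositive.
Variable Phi : (H -> H) -> H -> H.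
Hypothesis Phi_lin : linear_on M Phi.
Hypothesis Phi_pos : n_positive dot 2 M Phi.
Hypothesis Phi_contr : forall f, M f -> opnorm (Phi f) <= opnorm f.

Lemma two_positiveE A B C D : M A -> M B -> M C -> M D ->
  (forall u v, 0 <= dot (A u) u + dot (B v) u + (dot (C u) v + dot (D v) v)) ->
  forall u v, 0 <= dot (Phi A u) u + dot (Phi B v) u
                   + (dot (Phi C u) v + dot (Phi D v) v).
Proof.
move=> MA MB MC MD /positive_two_by_two h; apply/positive_two_by_two.
rewrite -map_two_by_two; apply: Phi_pos => // i j.
by rewrite mxE; case: ifP => _; case: ifP.
Qed.

Lemma vna_Phi x : M x -> M (Phi x).
Proof. exact: Phi_lin.1. Qed.

Lemma Phi0 : Phi 0 = 0.
Proof.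
have := Phi_lin.2 (-1) 0 0 vna0 vna0.
by rewrite scaler0 addr0 scaleN1r addNr.
Qed.

Lemma PhiZ a x : M x -> Phi (a *: x) = a *: Phi x.
Proof.
move=> Mx; rewrite -[a *: x]addr0 Phi_lin.2// ?Phi0 ?addr0//.
exact: vna0.
Qed.

Lemma PhiD x y : M x -> M y -> Phi (x + y) = Phi x + Phi y.
Proof. by move=> Mx My; rewrite -{1}[x]scale1r Phi_lin.2// scale1r. Qed.

Lemma PhiB x y : M x -> M y -> Phi (x - y) = Phi x - Phi y.
Proof.
by move=> Mx My; rewrite addrC -scaleN1r Phi_lin.2// scaleN1r addrC.
Qed.

(** This is 2-positivity at the matrix with [x] in one corner and zeros elsewhere. *)
Lemma Phi_positive_op x : M x -> positive_op x -> positive_op (Phi x).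
Proof.
move=> Mx px u.
have := @two_positiveE x 0 0 0 Mx vna0 vna0 vna0 _ u 0.
rewrite Phi0 !linear0r !linear0l /= !addr0; apply=> u' v.
by rewrite !linear0l /= !addr0.
Qed.

(** Only an inequality, as [H] may be zero. *)
Lemma opnorm_id : opnorm (idfun : H -> H) <= 1.
Proof. by apply: opnorm_le => // u; rewrite mul1r. Qed.

Lemma kadison_schwarz g u : M g ->
  rnorm (Phi g u) ^+ 2 <= rdot (Phi (abs2 dot g) u) u.
Proof.
move=> Mg; have Mg' := vna_adjoint Mg; have Mgg := vna_abs2 Mg.
pose S u v := dot (Phi idfun u) u + dot (Phi g v) u
   + (dot (Phi (adjoint dot g) u) v + dot (Phi (abs2 dot g) v) v).
have S0 : forall u v, 0 <= S u v.
  (* Before [Phi] is applied, the form of the matrix at [(u, v)] is [|u + g v|^2]. *)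
  apply: (two_positiveE vna_id Mg Mg' Mgg) => {}u v /=.
  rewrite /abs2 /= !dot_adjoint//; have := dnorm_ge0 dot (u + g v).
  by rewrite linearDl /= !linearDr /= addrACA.
have lin x : M x -> linear (Phi x) by move=> /vna_Phi/vna_bounded[].
(* That [Phi] respects adjoints is extracted from the reality of [S] by polarization; the real part
   is enough here. *)
have sym v w : rdot (Phi (adjoint dot g) w) v = rdot (Phi g v) w.
  apply: (@Re_polar _ _ (dot (Phi idfun ('i%C *: w)) ('i%C *: w)
                         + dot (Phi (abs2 dot g) v) v)).
    rewrite raddfD /= !ger0_Im ?addr0//; apply: Phi_positive_op => //.
      exact: positive_op_abs2.
    exact: vna_id.
  rewrite -[RHS](ger0_Im (S0 ('i%C *: w) v)); congr (complex.Im _).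
  rewrite /S (linear_opZ _ _ (lin _ Mg')) doti_l (doti_r (Phi g v) w).
  ring.
(* At [(-w, u)] the form [S] yields [2 |w|^2 <= <Phi 1 w, w> + <Phi |g|^2 u, u>], and contractivity
   bounds [<Phi 1 w, w>] by [|w|^2]. *)
pose w := Phi g u.
have : 0 <= complex.Re (S ((-1)%:C *: w) u).
  by have := S0 ((-1)%:C *: w) u; rewrite lecE => /andP[].
rewrite /S !raddfD /= -!/(rdot _ _).
rewrite (linear_opZ _ _ (lin _ Mg')) (linear_opZ _ _ (lin _ vna_id)).
rewrite !rdotZl !rdotZr sym -/w rdotuu.
have := rdot_le w (vna_bounded (vna_Phi vna_id)).
have := le_trans (Phi_contr vna_id) opnorm_id.
have := exprn_ge0 2 (rnorm_ge0 w).
nra.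
Qed.

End TwoPositive.

Lemma opnorm_mono x y : M x -> M y -> positive_op x ->
  (forall u, rdot (x u) u <= rdot (y u) u) -> opnorm x <= opnorm y.
Proof.
move=> Mx My px xy; apply: positive_op_opnorm_le => //.
- exact: (vna_bounded Mx).1.
- exact: opnorm_ge0 (vna_bounded My).
- by move=> u; apply: le_trans (xy u) _; exact: rdot_le (vna_bounded My).
Qed.

(** * The seminorms of a semigroup *)

Section Semigroup.
Variable T : R -> (H -> H) -> H -> H.
Hypothesis hT : semigroup_on M T.
Hypothesis hT2 : two_positive_contractive dot M T.

Definition lip_seminorm (t : R) (g : H -> H) : R :=
  Num.sqrt (opnorm (T t (abs2 dot g))).
Let p := lip_seminorm.

Let T_lin t : 0 < t -> linear_on M (T t).
Proof. by case: hT => h _ _; exact: h. Qed.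

Let T_pos t : 0 < t -> n_positive dot 2 M (T t).
Proof. by case: hT2 => h _ _; exact: h. Qed.

Let T_contr t f : 0 < t -> M f -> opnorm (T t f) <= opnorm f.
Proof. by case: hT2 => _ h _; exact: h. Qed.

Let TM t x : 0 < t -> M x -> M (T t x).
Proof. by move=> t0; exact: vna_Phi (T_lin t0) _. Qed.

Let T_add t s x : 0 < t -> 0 < s -> M x -> T (t + s) x = T t (T s x).
Proof. by case: hT => _ _ h ? ?; exact: h. Qed.

Lemma lip_seminorm_ge0 t g : 0 <= p t g.
Proof. exact: sqrtr_ge0. Qed.

Lemma lip_seminorm_sqr t g : 0 < t -> M g -> p t g ^+ 2 = opnorm (T t (abs2 dot g)).
Proof.
move=> t0 Mg; rewrite /p /lip_seminorm sqr_sqrtr//.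
by apply: opnorm_ge0; apply: vna_bounded; apply: TM => //; exact: vna_abs2.
Qed.

Lemma T_mono t x y u : 0 < t -> M x -> M y ->
  (forall v, rdot (x v) v <= rdot (y v) v) -> positive_op x -> positive_op y ->
  rdot (T t x u) u <= rdot (T t y u) u.
Proof.
move=> t0 Mx My xy px py.
have : positive_op (T t (y - x)).
  apply: Phi_positive_op (T_lin t0) (T_pos t0) _ (vnaB My Mx) _ => v.
  have -> : dot ((y - x) v) v = dot (y v) v - dot (x v) v by rewrite -linearBl.
  (* The hypothesis compares real parts only; [px] and [py] make the imaginary parts vanish. *)
  rewrite lecE raddfB /= !ger0_Im ?subr0 ?eqxx//.
  by rewrite raddfB subr_ge0; exact: xy.
move=> /(_ u); rewrite (PhiB (T_lin t0))// lecE => /andP[_].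
have -> : dot ((T t y - T t x) u) u = dot (T t y u) u - dot (T t x u) u.
  by rewrite -linearBl.
by rewrite raddfB /= subr_ge0.
Qed.

(** The pointwise hypothesis is the operator inequality [|x|^2 <= a |y|^2 + b |z|^2]. It is
    preserved by the positive map [T t], and norms of positive operators are controlled by their
    quadratic forms. *)
Lemma lip_seminorm_comb t x y z a b : 0 < t -> M x -> M y -> M z ->
  0 <= a -> 0 <= b ->
  (forall u, rnorm (x u) ^+ 2 <= a * rnorm (y u) ^+ 2 + b * rnorm (z u) ^+ 2) ->
  p t x ^+ 2 <= a * p t y ^+ 2 + b * p t z ^+ 2.
Proof.
move=> t0 Mx My Mz a0 b0 hx; rewrite !lip_seminorm_sqr//.
have [Mx2 My2 Mz2] := And3 (vna_abs2 Mx) (vna_abs2 My) (vna_abs2 Mz).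
have bdd g : M g -> bounded_op (T t (abs2 dot g)).
  by move=> Mg; apply: vna_bounded; apply: TM => //; exact: vna_abs2.
pose W := a%:C *: abs2 dot y + b%:C *: abs2 dot z.
have MW : M W by apply: vna_comb => //; exact: vnaZ.
have WE u : dot (W u) u = (a * rnorm (y u) ^+ 2 + b * rnorm (z u) ^+ 2)%:C.
  have -> : dot (W u) u = a%:C * dot (abs2 dot y u) u + b%:C * dot (abs2 dot z u) u.
    by rewrite -!linearZl_LR -linearDl.
  by rewrite /abs2 /= !dot_adjoint// !dotuu -!rmorphM -rmorphD.
have TWE u : rdot (T t W u) u =
  a * rdot (T t (abs2 dot y) u) u + b * rdot (T t (abs2 dot z) u) u.
  rewrite (T_lin t0).2//; last exact: vnaZ.
  by rewrite (PhiZ (T_lin t0))// -!rdotZl -rdotDl.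
apply: positive_op_opnorm_le.
- exact: (bdd _ Mx).1.
- by apply: Phi_positive_op (T_lin t0) (T_pos t0) _ Mx2 _; exact: positive_op_abs2.
- by rewrite addr_ge0// mulr_ge0// opnorm_ge0//; exact: bdd.
- move=> u; apply: le_trans (@T_mono t _ W u t0 Mx2 MW _ _ _) _.
  + by move=> v; rewrite rdot_abs2// /rdot WE.
  + exact: positive_op_abs2.
  + by move=> v; rewrite WE ler0c addr_ge0// mulr_ge0// exprn_ge0// rnorm_ge0.
  + rewrite TWE mulrDl -!mulrA lerD// ler_wpM2l// rdot_le//; exact: bdd.
Qed.

(** The weighted inequality [(X + Y)^2 <= (a + b)/a X^2 + (a + b)/b Y^2] reduces the triangle
    inequality to squares; it is sharp for [a], [b] proportional to [X], [Y]. The pointwise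
    hypothesis covers sums and differences alike. *)
Lemma lip_seminormD t x y z : 0 < t -> M x -> M y -> M z ->
  (forall u, rnorm (z u) <= rnorm (x u) + rnorm (y u)) -> p t z <= p t x + p t y.
Proof.
move=> t0 Mx My Mz hz; apply/ler_addgt0Pr => e e0.
have px0 := lip_seminorm_ge0 t x; have py0 := lip_seminorm_ge0 t y.
(* The added [e / 2] keeps the weights positive when a seminorm vanishes. *)
pose a := p t x + e / 2; pose b := p t y + e / 2.
have a0 : 0 < a by rewrite /a; lra.
have b0 : 0 < b by rewrite /b; lra.
have -> : p t x + p t y + e = a + b by rewrite /a /b; lra.
rewrite -(@ler_pXn2r _ 2) ?nnegrE ?lip_seminorm_ge0//; last by lra.
apply: (@le_trans _ _ ((a + b) / a * p t x ^+ 2 + (a + b) / b * p t y ^+ 2)).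
  apply: lip_seminorm_comb => //; try by apply: divr_ge0; lra.
  move=> u; apply: (@le_trans _ _ ((rnorm (x u) + rnorm (y u)) ^+ 2)).
    by apply: lerXn2r; rewrite ?nnegrE ?rnorm_ge0 ?addr_ge0 ?rnorm_ge0.
  rewrite -subr_ge0.
  have -> : (a + b) / a * rnorm (x u) ^+ 2 + (a + b) / b * rnorm (y u) ^+ 2 -
    (rnorm (x u) + rnorm (y u)) ^+ 2 =
    (b * rnorm (x u) - a * rnorm (y u)) ^+ 2 / (a * b).
    by field; rewrite !gt_eqF.
  by rewrite divr_ge0 ?sqr_ge0// mulr_ge0// ltW.
have -> : (a + b) ^+ 2 = (a + b) / a * a ^+ 2 + (a + b) / b * b ^+ 2.
  by field; rewrite !gt_eqF.
have h g c : p t g <= c -> p t g ^+ 2 <= c ^+ 2.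
  have g0 := lip_seminorm_ge0 t g; move=> gc.
  by apply: lerXn2r; rewrite ?nnegrE// (le_trans g0).
apply: lerD; (apply: ler_wpM2l; [by apply: divr_ge0; lra|]); apply: h.
  by rewrite /a; lra.
by rewrite /b; lra.
Qed.

Lemma lip_seminorm_double t x : 0 < t -> M x -> 2 * p t x <= p t (x + x).
Proof.
move=> t0 Mx.
have h : p t x ^+ 2 <= 4^-1 * p t (x + x) ^+ 2 + 0 * p t x ^+ 2.
  apply: lip_seminorm_comb => //; first exact: vnaD.
  move=> u; have -> : (x + x) u = 2%:C *: x u.
    by rewrite fctE -mulr2n -scaler_nat rmorph_nat.
  by rewrite rnormZ ger0_norm//; lra.
rewrite -(@ler_pXn2r _ 2) ?nnegrE ?mulr_ge0 ?lip_seminorm_ge0//.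
by rewrite exprMn; lra.
Qed.

Lemma lip_seminorm_opnorm t x : 0 < t -> M x -> p t x <= opnorm x.
Proof.
move=> t0 Mx; have bx := vna_bounded Mx.
rewrite -(@ler_pXn2r _ 2) ?nnegrE ?lip_seminorm_ge0 ?opnorm_ge0//.
rewrite lip_seminorm_sqr//; apply: le_trans (T_contr t0 (vna_abs2 Mx)) _.
apply: opnorm_abs2_le => //; first exact: opnorm_ge0.
by move=> u; exact: le_opnorm.
Qed.

Let KS t g u : 0 < t -> M g ->
  rnorm (T t g u) ^+ 2 <= rdot (T t (abs2 dot g) u) u.
Proof.
move=> t0 Mg; apply: kadison_schwarz (T_lin t0) (T_pos t0) _ _ _ Mg => f.
exact: T_contr.
Qed.

Lemma opnorm_T_le t x : 0 < t -> M x -> opnorm (T t x) <= p t x.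
Proof.
move=> t0 Mx; apply: opnorm_le; first exact: lip_seminorm_ge0.
move=> u; have p0 := lip_seminorm_ge0 t x.
rewrite -(@ler_pXn2r _ 2) ?nnegrE ?mulr_ge0 ?rnorm_ge0//.
rewrite exprMn lip_seminorm_sqr//; apply: le_trans (KS u t0 Mx) _.
by apply: rdot_le; apply: vna_bounded; apply: TM => //; exact: vna_abs2.
Qed.

Lemma lip_seminorm_T_smooth t s x : 0 < t -> 0 < s -> M x -> p t (T s x) <= p s x.
Proof.
move=> t0 s0 Mx; apply: le_trans (lip_seminorm_opnorm t0 (TM s0 Mx)) _.
exact: opnorm_T_le.
Qed.

Lemma lip_seminorm_T t s x : 0 < t -> 0 < s -> M x -> p t (T s x) <= p t x.
Proof.
move=> t0 s0 Mx; have MT := TM s0 Mx; have Mx2 := vna_abs2 Mx.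
rewrite -(@ler_pXn2r _ 2) ?nnegrE ?lip_seminorm_ge0// !lip_seminorm_sqr//.
apply: (@le_trans _ _ (opnorm (T t (T s (abs2 dot x))))).
  have pT : positive_op (T s (abs2 dot x)).
    by apply: Phi_positive_op (T_lin s0) (T_pos s0) _ Mx2 _; exact: positive_op_abs2.
  apply: opnorm_mono.
  - by apply: TM => //; exact: vna_abs2.
  - by apply: TM => //; exact: TM.
  - apply: Phi_positive_op (T_lin t0) (T_pos t0) _ (vna_abs2 MT) _.
    exact: positive_op_abs2.
  - move=> u; apply: T_mono => //.
    + exact: vna_abs2.
    + exact: TM.
    + by move=> v; rewrite rdot_abs2//; exact: KS.
    + exact: positive_op_abs2.
(* Exchanging [T t] and [T s] puts [T s] outside, where contractivity removes it. *)
by rewrite -T_add// addrC T_add// T_contr//; exact: TM.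
Qed.

End Semigroup.
End Algebra.
End Operators.

(** * Comparison of the Lipschitz norms of different orders *)

Section Comparison.
Context {R : realType} {H : completeNormedModType R[i]}.
Variable dot : {dot H for Num.conj}.
Hypothesis hH : is_hilbert dot.
Variables (M : set (H -> H)) (T : R -> (H -> H) -> H -> H) (alpha : R).
Hypothesis hM : von_neumann_algebra dot M.
Hypothesis hT : semigroup_on M T.
Hypothesis hT2 : two_positive_contractive dot M T.
Hypothesis halpha : 0 < alpha.

(** A real bound [A] for the supremum in [lip_norm], which keeps the change of order free of
    extended reals. *)
Definition lip_bound (k : nat) (f : H -> H) (A : R) := forall t, 0 < t ->
  lip_seminorm dot T t (iter k (fun g => g - T t g) f) <= A * t `^ alpha.

Let T_lin t : 0 < t -> linear_on M (T t).
Proof. by case: hT => h _ _; exact: h. Qed.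

Let TM t x : 0 < t -> M x -> M (T t x).
Proof. by move=> t0; exact: (T_lin t0).1. Qed.

Let pD t x y : 0 < t -> M x -> M y ->
  lip_seminorm dot T t (x + y) <= lip_seminorm dot T t x + lip_seminorm dot T t y.
Proof.
move=> t0 Mx My; apply: (lip_seminormD hH hM hT hT2) => //; first exact: (vnaD hM).
by move=> u; exact: rnormD.
Qed.

Let pB t x y : 0 < t -> M x -> M y ->
  lip_seminorm dot T t (x - y) <= lip_seminorm dot T t x + lip_seminorm dot T t y.
Proof.
move=> t0 Mx My; apply: (lip_seminormD hH hM hT hT2) => //; first exact: (vnaB hM).
by move=> u; apply: le_trans (rnormD _ _) _; rewrite /rnorm normrN.
Qed.

Lemma lip_bound_succ k f A : M f -> lip_bound k f A -> lip_bound k.+1 f (2 * A).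
Proof.
move=> Mf h t; apply: (seminorm_difference_succ (vnaB hM) TM pB) => //.
exact: (lip_seminorm_T hH hM hT hT2).
Qed.

Lemma lip_bound_pred k : alpha < k%:R ->
  exists2 C, 0 <= C &
    forall f A, M f -> 0 <= A -> lip_bound k.+1 f A -> lip_bound k f (C * A).
Proof.
move=> ak; apply: (seminorm_difference_pred (vnaD hM) (vnaB hM) TM) => //.
- by move=> t x y t0; exact: (PhiD (T_lin t0)).
- by move=> t x y t0; exact: (PhiB (T_lin t0)).
- by case: hT => _ _ h t x t0; exact: h.
- exact: lip_seminorm_ge0.
- exact: (lip_seminorm_double hH hM hT hT2).
- exact: (lip_seminorm_T hH hM hT hT2).
- exact: (lip_seminorm_T_smooth hH hM hT hT2).
- exact: (lip_seminorm_opnorm hH hM hT hT2).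
Qed.

Lemma lip_bound_addr k d f A : M f -> lip_bound k f A ->
  lip_bound (k + d) f (2 ^+ d * A).
Proof.
move=> Mf h; elim: d => [|d IH]; first by rewrite addn0 mul1r.
by rewrite addnS exprS -mulrA; exact: lip_bound_succ.
Qed.

(** The order is lowered one step at a time; every order reached is at least [k], hence exceeds
    [alpha] as Marchaud's inequality requires. *)
Lemma lip_bound_subr k d : alpha < k%:R ->
  exists2 C, 0 <= C & forall f A, M f -> 0 <= A ->
    lip_bound (k + d) f A -> lip_bound k f (C * A).
Proof.
move=> ak; elim: d => [|d [C C0 IH]].
  by exists 1 => // f A _ _; rewrite addn0 mul1r.
have [|C' C'0 h] := @lip_bound_pred (k + d).
  by apply: lt_le_trans ak _; rewrite ler_nat leq_addr.
exists (C * C'); first exact: mulr_ge0.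
move=> f A Mf A0; rewrite addnS => /(h _ _ Mf A0) /IH.
by rewrite mulrA; apply=> //; exact: mulr_ge0.
Qed.

Lemma lip_bound_transfer i j : alpha < i%:R -> alpha < j%:R ->
  exists2 C, 0 <= C & forall f A, M f -> 0 <= A ->
    lip_bound i f A -> lip_bound j f (C * A).
Proof.
move=> ai aj; have [ij|/ltnW ji] := leqP i j.
  exists (2 ^+ (j - i)); first exact: exprn_ge0.
  by move=> f A Mf A0 /(lip_bound_addr (j - i) Mf); rewrite subnKC.
have [C C0 h] := lip_bound_subr (i - j) aj.
by exists C => // f A Mf A0; rewrite subnKC// in h *; exact: h.
Qed.

Lemma lip_norm_le k f A : 0 <= A -> lip_bound k f A ->
  (lip_norm dot T alpha k f <= (opnorm f + A)%:E)%E.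
Proof.
move=> A0 h; rewrite /lip_norm EFinD leeD2l//.
apply: ge_ereal_sup => _ [t /= t0 <-]; rewrite lee_fin.
by rewrite mulrC ler_pdivrMr ?powR_gt0//; exact: h.
Qed.

Lemma lip_norm_finite k f : (lip_norm dot T alpha k f < +oo)%E ->
  exists A, [/\ 0 <= A, lip_bound k f A &
    lip_norm dot T alpha k f = (opnorm f + A)%:E].
Proof.
rewrite /lip_norm; set E := [set _ | _ in _] => fin.
have ub t : 0 < t -> ((lip_seminorm dot T t (iter k (fun g => g - T t g) f) /
    t `^ alpha)%:E <= ereal_sup E)%E.
  by move=> t0; apply: ereal_sup_ubound; exists t => //; rewrite mulrC.
(* The value at [t = 1] rules out a supremum equal to [-oo]. *)
have sup0 : (0 <= ereal_sup E)%E.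
  apply: le_trans (ub 1 ltr01); rewrite lee_fin.
  by rewrite divr_ge0 ?powR_ge0//; exact: lip_seminorm_ge0.
case: (ereal_sup E) sup0 ub fin => [A|//|//] A0 ub _.
exists A; split => // t t0.
by have := ub t t0; rewrite lee_fin ler_pdivrMr ?powR_gt0.
Qed.

Lemma lip_norm_compare i j : alpha < i%:R -> alpha < j%:R ->
  exists2 C : R, 0 < C & forall f, M f ->
    (lip_norm dot T alpha j f <= C%:E * lip_norm dot T alpha i f)%E.
Proof.
move=> ai aj; have [C C0 h] := lip_bound_transfer ai aj.
(* [1 + C] dominates the coefficient [1] of [opnorm f] and the coefficient [C] of the supremum;
   being positive, it also settles the infinite case. *)
exists (1 + C) => [|f Mf]; first by lra.
have [/eqP ->|fin] := boolP (lip_norm dot T alpha i f == +oo%E).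
  by rewrite gt0_muley ?leey// lte_fin; lra.
rewrite -ltey in fin; have [A [A0 hA ->]] := lip_norm_finite fin.
apply: le_trans (lip_norm_le (mulr_ge0 C0 A0) (h _ _ Mf A0 hA)) _.
rewrite -EFinM lee_fin.
have := mulr_ge0 C0 (opnorm_ge0 (vna_bounded hM Mf)); lra.
Qed.

End Comparison.

Theorem theorem1p4 (R : realType) (H : completeNormedModType R[i])
    (dot : {dot H for Num.conj}) (hH : is_hilbert dot)
    (M : set (H -> H)) (hM : von_neumann_algebra dot M)
    (T : R -> (H -> H) -> (H -> H)) (hT : semigroup_on M T)
    (hT2 : two_positive_contractive dot M T) (hTan : analytic dot M T)
    (alpha : R) (halpha : 0 < alpha) (k : nat) (hk : alpha < k%:R) :
  lip_space dot M T alpha k = lip_space dot M T alpha (Num.truncn alpha).+1 /\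
  exists c C : R, [/\ 0 < c, 0 < C &
    forall f, lip_space dot M T alpha k f ->
      (c%:E * lip_norm dot T alpha (Num.truncn alpha).+1 f
         <= lip_norm dot T alpha k f)%E /\
      (lip_norm dot T alpha k f
         <= C%:E * lip_norm dot T alpha (Num.truncn alpha).+1 f)%E].
Proof.
(* The order [[alpha] + 1] also exceeds [alpha], so the comparison applies in both directions. *)
have hm : alpha < (Num.truncn alpha).+1%:R by exact: truncnS_gt.
have [C C0 hC] := lip_norm_compare hH hM hT hT2 halpha hm hk.
have [c c0 hc] := lip_norm_compare hH hM hT hT2 halpha hk hm.
split.
  have trans i j (b : R) : (forall f, M f ->
      lip_norm dot T alpha j f <= b%:E * lip_norm dot T alpha i f)%E ->
      lip_space dot M T alpha i `<=` lip_space dot M T alpha j.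
    move=> hb f [Mf /lip_norm_finite[A [_ _ fA]]]; split=> //.
    by apply: le_lt_trans (hb f Mf) _; rewrite fA -EFinM ltry.
  by apply/seteqP; split; [exact: trans hc | exact: trans hC].
(* The lower constant is the inverse of the constant of the reverse comparison. *)
exists c^-1, C; split=> //; first by rewrite invr_gt0.
move=> f [Mf _]; split; last exact: hC.
by rewrite muleC lee_pdivrMr// muleC hc.
Qed.
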